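(* Let $r\in\mathbb{N}$, let $g$ be a polynomial with integer coefficients and $G=(g,\ldots,g)$ ($r$ copies). If $m_1,\ldots,m_r\in\mathbb{N}$ are pairwise relatively prime and $m=\operatorname{lcm}(m_1,\ldots,m_r)$, then $R_G(m_1,\ldots,m_r)=R_g(m)$.
   Context: For $n\in\mathbb{N}$ and $k\in\mathbb{Z}$, $c_n(k)=\sum_{1\le j\le n,\ \gcd(j,n)=1}\exp(2\pi i jk/n)$ is the Ramanujan sum. $R_G(m_1,\ldots,m_r)=\sum_{1\le k\le m,\ \gcd(k,m)=1}c_{m_1}(g(k))\cdots c_{m_r}(g(k))$ with $m=\operatorname{lcm}(m_1,\ldots,m_r)$, and $R_g(n)=\sum_{1\le k\le n,\ \gcd(k,n)=1}c_n(g(k))$. *)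

(* Defs.v *)
From mathcomp Require Import all_boot all_order all_algebra.
From mathcomp Require Import complex.
From mathcomp Require Import reals sequences trigo.

Set Implicit Arguments.
Unset Strict Implicit.
Unset Printing Implicit Defensive.

Import GRing.Theory Num.Theory.
Local Open Scope ring_scope.
Local Open Scope complex_scope.

(* exp (x + iy) = e^x (cos y + i sin y). *)
Definition cexp (R : realType) (z : R[i]) : R[i] :=
  (expR (complex.Re z))%:C * (cos (complex.Im z) +i* sin (complex.Im z)).

Definition ramanujan_sum (R : realType) (n : nat) (k : int) : R[i] :=
  \sum_(1 <= j < n.+1 | coprime j n)
    cexp (2 * (pi : R)%:C * 'i * j%:R * k%:~R / n%:R).

Definition lcm_fam (r : nat) (m : 'I_r -> nat) : nat :=
  \big[lcmn/1%N]_(i < r) m i.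

Definition R_fam (R : realType) (r : nat) (G : 'I_r -> {poly int})
    (m : 'I_r -> nat) : R[i] :=
  \sum_(1 <= k < (lcm_fam m).+1 | coprime k (lcm_fam m))
    \prod_(i < r) ramanujan_sum R (m i) (G i).[k%:Z].

Definition R_single (R : realType) (g : {poly int}) (n : nat) : R[i] :=
  \sum_(1 <= k < n.+1 | coprime k n) ramanujan_sum R n g.[k%:Z].

(* Main.v *)
Require Import Defs.
From mathcomp Require Import all_boot all_order all_algebra.
From mathcomp Require Import complex.
From mathcomp Require Import reals sequences trigo.
From mathcomp Require Import exp ring.

(** For coprime [a], [b], the Chinese remainder theorem says that
    [(u, v) |-> u b + v a] maps the pairs of units mod [a] and mod [b]
    bijectively onto the units mod [a b]; since [e(u/a) e(v/b) =
    e((u b + v a) / (a b))], the Ramanujan sum [c_n(k)] is multiplicative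
    in [n].  Hence the product in the definition of [R_G] collapses to
    [c_m(g(k))], term by term. *)

Set Implicit Arguments.
Unset Strict Implicit.
Unset Printing Implicit Defensive.

Import GRing.Theory Num.Theory.
Local Open Scope ring_scope.
Local Open Scope complex_scope.

Lemma lcmn_coprime (a b : nat) : coprime a b -> lcmn a b = (a * b)%N.
Proof. by move=> /eqP ab; rewrite -muln_lcm_gcd ab muln1. Qed.

Lemma coprime_prodr (n : nat) (I : Type) (s : seq I) (m : I -> nat) :
  coprime n (\prod_(i <- s) m i) = all (coprime n) [seq m i | i <- s].
Proof.
elim: s => [|i s IHs]; first by rewrite big_nil coprimen1.
by rewrite big_cons coprimeMr IHs.
Qed.

Lemma biglcmn_coprime (I : Type) (s : seq I) (m : I -> nat) :
  pairwise coprime [seq m i | i <- s] ->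
  \big[lcmn/1%N]_(i <- s) m i = (\prod_(i <- s) m i)%N.
Proof.
elim: s => [|i s IHs] /=; first by rewrite !big_nil.
case/andP=> cop_i /IHs lcm_s.
by rewrite !big_cons lcm_s lcmn_coprime // coprime_prodr.
Qed.

Definition arith_multiplicative (S : pzSemiRingType) (f : nat -> S) : Prop :=
  f 1%N = 1 /\ forall a b, coprime a b -> f (a * b)%N = f a * f b.

Lemma arith_multiplicative_prod (S : pzSemiRingType) (f : nat -> S)
    (I : Type) (s : seq I) (m : I -> nat) :
  arith_multiplicative f -> pairwise coprime [seq m i | i <- s] ->
  f (\prod_(i <- s) m i)%N = \prod_(i <- s) f (m i).
Proof.
case=> f1 fM; elim: s => [|i s IHs] /=; first by rewrite !big_nil.
by case/andP=> cop_i /IHs f_s; rewrite !big_cons fM ?f_s // coprime_prodr.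
Qed.

Section ChineseRemainder.
Implicit Types a b u v : nat.

Lemma eqn_modMr_coprime a b u v : coprime a b ->
  (u * b == v * b %[mod a]) = (u == v %[mod a]).
Proof.
move=> ab; wlog vu : u v / (v <= u)%N => [eq_le|].
  by case/orP: (leq_total v u) => /eq_le // E; rewrite eq_sym E eq_sym.
by rewrite !eqn_mod_dvd ?leq_mul2r ?vu ?orbT // -mulnBl Gauss_dvdl.
Qed.

Lemma eqn_mod_muladd a b u v u' v' : coprime a b ->
  (u * b + v * a == u' * b + v' * a %[mod a * b]) =
  (u == u' %[mod a]) && (v == v' %[mod b]).
Proof.
move=> ab; rewrite chinese_remainder // !modnMDl.
rewrite ![(_ + _ * a)%N]addnC !modnMDl.
by rewrite !eqn_modMr_coprime // coprime_sym.
Qed.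

Lemma coprime_muladd a b u v : coprime a b ->
  coprime (u * b + v * a) a = coprime u a.
Proof.
move=> ab; rewrite -coprime_modl addnC modnMDl coprime_modl coprimeMl.
by rewrite [coprime b a]coprime_sym ab andbT.
Qed.

Lemma ord_pair_muln_gt0 a b (p : 'I_a * 'I_b) : (0 < a * b)%N.
Proof.
case: p => u v; rewrite muln_gt0 (leq_ltn_trans _ (ltn_ord u)) //.
exact: leq_ltn_trans (ltn_ord v).
Qed.

Definition crt_ord a b (p : 'I_a * 'I_b) : 'I_(a * b) :=
  Ordinal (ltn_pmod (p.1 * b + p.2 * a) (ord_pair_muln_gt0 p)).

Lemma crt_ord_bij a b : coprime a b -> bijective (@crt_ord a b).
Proof.
move=> ab; apply: inj_card_bij; last by rewrite card_prod !card_ord.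
move=> [u v] [u' v'] /(congr1 val)/= /eqP; rewrite eqn_mod_muladd //.
by rewrite !modn_small // => /andP[/eqP/val_inj-> /eqP/val_inj->].
Qed.

Lemma coprime_crt_ord a b (p : 'I_a * 'I_b) : coprime a b ->
  coprime (crt_ord p) (a * b) = coprime p.1 a && coprime p.2 b.
Proof.
move=> ab; rewrite coprime_modl coprimeMr coprime_muladd // addnC.
by rewrite coprime_muladd // coprime_sym.
Qed.

End ChineseRemainder.

Section BigCoprime.
Variables (T : Type) (idx : T) (op : Monoid.com_law idx).
Implicit Types (a b n : nat) (F : nat -> T).

Lemma big_coprime_ord n F : F n = F 0%N ->
  \big[op/idx]_(1 <= j < n.+1 | coprime j n) F j =
  \big[op/idx]_(j < n | coprime j n) F j.
Proof.
case: n => [|n] Fn; first by rewrite big_geq // big_ord0.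
rewrite big_mkcond big_add1 big_nat_recr //=.
rewrite -(big_mkord (fun j => coprime j n.+1)) [RHS]big_mkcond big_nat_recl //=.
by rewrite Monoid.mulmC Fn /coprime gcdnn gcd0n.
Qed.

Lemma big_coprime_crt a b F :
  coprime a b -> (forall j, F (j %% (a * b))%N = F j) ->
  \big[op/idx]_(j < a * b | coprime j (a * b)) F j =
  \big[op/idx]_(u < a | coprime u a)
    \big[op/idx]_(v < b | coprime v b) F (u * b + v * a)%N.
Proof.
move=> ab F_mod; rewrite (reindex (@crt_ord a b)) /=; last first.
  exact/onW_bij/crt_ord_bij.
by rewrite pair_big; apply: eq_big => p; rewrite ?coprime_crt_ord ?F_mod.
Qed.

End BigCoprime.

Definition coprime_power_sum (S : pzSemiRingType) (n : nat) (z : S) : S :=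
  \sum_(1 <= j < n.+1 | coprime j n) z ^+ j.

Lemma coprime_power_sumM (S : pzSemiRingType) (a b : nat) (z : S) :
  coprime a b -> z ^+ (a * b) = 1 ->
  coprime_power_sum (a * b) z =
  coprime_power_sum a (z ^+ b) * coprime_power_sum b (z ^+ a).
Proof.
move=> ab z1; have zb1 : (z ^+ b) ^+ a = 1 by rewrite -exprM mulnC.
have za1 : (z ^+ a) ^+ b = 1 by rewrite -exprM.
rewrite /coprime_power_sum !big_coprime_ord //.
rewrite big_coprime_crt // => [|j]; last exact: expr_mod.
rewrite big_distrlr /=; apply: eq_bigr => u _; apply: eq_bigr => v _.
by rewrite exprD -!exprM (mulnC b) (mulnC a).
Qed.

Section ComplexExponential.
Variable R : realType.
Implicit Types (z w : R[i]) (n : nat) (k : int).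

Lemma cexpD z w : cexp (z + w) = cexp z * cexp w.
Proof.
case: z w => [x y] [x' y']; rewrite /cexp /= expRD cosD sinD.
by apply/eqP; rewrite eq_complex /=; apply/andP; split; apply/eqP; ring.
Qed.

Lemma cexp0 : cexp (0 : R[i]) = 1.
Proof. by rewrite /cexp /= expR0 cos0 sin0 mul1r. Qed.

Lemma cexpN z : cexp (- z) = (cexp z)^-1.
Proof. by apply/esym/mulr1_eq; rewrite -cexpD subrr cexp0. Qed.

Lemma cexpMn z n : cexp (z *+ n) = cexp z ^+ n.
Proof.
by elim: n => [|n IHn]; rewrite ?mulr0n ?cexp0 // mulrS exprS cexpD IHn.
Qed.

Lemma cexpMz z k : cexp (z *~ k) = cexp z ^ k.
Proof.
by case: k => n; [exact: cexpMn | rewrite NegzE mulrNz cexpN cexpMn exprnN].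
Qed.

Lemma cexp_2pi_i : cexp (2 * (pi : R)%:C * 'i) = 1.
Proof.
rewrite /cexp -complexiE mulr_natl mulr2n /=.
rewrite !(mul0r, mulr0, mulr1, addr0, add0r, subr0, oppr0).
by rewrite -mulr2n cos2pi sin2pi expR0 mul1r.
Qed.

End ComplexExponential.

Section RamanujanSum.
Variable R : realType.
Implicit Types (a b n : nat) (k : int).

Definition unity_root n k : R[i] :=
  cexp (2 * (pi : R)%:C * 'i * k%:~R / n%:R).

Lemma unity_root1 k : unity_root 1 k = 1.
Proof. by rewrite /unity_root divr1 mulrzr cexpMz cexp_2pi_i exp1rz. Qed.

Lemma unity_root_mulX a b k : (0 < b)%N ->
  unity_root (a * b) k ^+ b = unity_root a k.
Proof.
move=> b_gt0; rewrite -cexpMn -[X in cexp X]mulr_natr natrM invfM mulrA.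
by rewrite divfK // pnatr_eq0 -lt0n.
Qed.

Lemma unity_rootX n k : unity_root n k ^+ n = 1.
Proof.
have [->//|n_gt0] := posnP n.
by rewrite -[X in unity_root X]mul1n unity_root_mulX ?unity_root1.
Qed.

Lemma ramanujan_sumE n k :
  ramanujan_sum R n k = coprime_power_sum n (unity_root n k).
Proof.
apply: eq_bigr => j _; rewrite -cexpMn; congr cexp.
by rewrite -[RHS]mulr_natr [RHS]mulrAC [X in _ = X / _]mulrAC.
Qed.

Lemma ramanujan_sum0 k : ramanujan_sum R 0 k = 0.
Proof. exact: big_geq. Qed.

Lemma ramanujan_sum1 k : ramanujan_sum R 1 k = 1.
Proof.
by rewrite ramanujan_sumE /coprime_power_sum big_mkcond big_nat1 unity_root1.
Qed.

Lemma ramanujan_sum_multiplicative k :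
  arith_multiplicative (ramanujan_sum R ^~ k).
Proof.
split=> [|a b ab]; first exact: ramanujan_sum1.
have [->|a_gt0] := posnP a; first by rewrite !ramanujan_sum0 mul0r.
have [->|b_gt0] := posnP b; first by rewrite muln0 !ramanujan_sum0 mulr0.
rewrite !ramanujan_sumE coprime_power_sumM ?unity_rootX //.
by rewrite unity_root_mulX // mulnC unity_root_mulX.
Qed.

End RamanujanSum.

Theorem corollary7 (R : realType) (r : nat) (hr : (0 < r)%N)
    (g : {poly int}) (m : 'I_r -> nat)
    (m_pos : forall i : 'I_r, (0 < m i)%N)
    (m_coprime : forall i j : 'I_r, i != j -> coprime (m i) (m j)) :
  R_fam R (fun _ : 'I_r => g) m = R_single R g (lcm_fam m).
Proof.
have cop_m : pairwise coprime [seq m i | i <- index_enum 'I_r].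
  rewrite pairwise_map (sub_pairwise m_coprime) //.
  by rewrite -uniq_pairwise index_enum_uniq.
apply: eq_bigr => k _; rewrite /lcm_fam biglcmn_coprime //.
exact/esym/(arith_multiplicative_prod (ramanujan_sum_multiplicative R _)).
Qed.
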